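(* Let $\ell\ge 2$ and $m\ge\max\{2\ell-2,4\}$ be integers. Then the binary hypercube of dimension $m$ belongs to $\mathfrak{Gr}(2^m,\,2^m-m+2\ell-2,\,\ell)$.
   Context: All graphs are finite, simple and undirected. The binary hypercube of dimension $m$ has vertex set $\{0,1\}^m$, two vertices being adjacent if and only if they differ in exactly one coordinate. For a graph $G=(V,E)$ and $x\in V$, $N[x]=\{x\}\cup\{y: xy\in E\}$; for $X\subseteq V$, $N[X]=\bigcup_{x\in X}N[x]$ (so $N[\emptyset]=\emptyset$). A set $C\subseteq V$ is $(1,\le\ell)$-identifying if $N[X]\cap C\neq N[Y]\cap C$ for all distinct $X,Y\subseteq V$ with $|X|\le\ell$, $|Y|\le\ell$. For $n\ge k\ge1$ and $\ell\ge1$, $\mathfrak{Gr}(n,k,\ell)$ is the set of graphs on $n$ vertices in which every $k$-element subset of vertices is $(1,\le\ell)$-identifying. *)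

(* Defs.v *)
From mathcomp Require Import all_boot.

Set Implicit Arguments.
Unset Strict Implicit.
Unset Printing Implicit Defensive.

Record sgraph := SGraph {
  vertex :> finType;
  adj : rel vertex;
  adj_sym : symmetric adj;
  adj_irrefl : irreflexive adj }.

Definition closed_nbr (G : sgraph) (x : G) : {set G} :=
  x |: [set y | adj x y].

Definition closed_nbrs (G : sgraph) (X : {set G}) : {set G} :=
  \bigcup_(x in X) closed_nbr x.

(* [C] is (1, <= l)-identifying; [X] and [Y] may be empty. *)
Definition identifying (G : sgraph) (l : nat) (C : {set G}) : Prop :=
  forall X Y : {set G}, X != Y -> #|X| <= l -> #|Y| <= l ->
    closed_nbrs X :&: C != closed_nbrs Y :&: C.

(* The range [1 <= k <= n], [1 <= l] in which the class is defined is part of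
   the predicate, so membership never holds outside it. *)
Definition Gr (n k l : nat) (G : sgraph) : Prop :=
  [/\ 1 <= k <= n, 1 <= l, #|G| = n &
      forall C : {set G}, #|C| = k -> identifying l C].

Definition cube_adj (m : nat) : rel {ffun 'I_m -> bool} :=
  fun x y => #|[set i | x i != y i]| == 1.

Lemma cube_adj_sym m : symmetric (@cube_adj m).
Proof.
move=> x y; rewrite /cube_adj; congr (_ == _); apply: eq_card => i.
by rewrite !inE eq_sym.
Qed.

Lemma cube_adj_irrefl m : irreflexive (@cube_adj m).
Proof.
move=> x; rewrite /cube_adj (_ : [set i | x i != x i] = set0) ?cards0 //.
by apply/setP=> i; rewrite !inE eqxx.
Qed.

Definition hypercube (m : nat) : sgraph :=
  SGraph (@cube_adj_sym m) (@cube_adj_irrefl m).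

(* Main.v *)
Require Import Defs.
From mathcomp Require Import all_boot.
From mathcomp Require Import zify.

(* It suffices that N[X] and N[Y] differ in at least m + 3 - 2l vertices.
   Closed neighbourhoods have m + 1 points, two of them share at most two points,
   and three that pairwise meet have a common point.  If x lies in X but not in
   Y, then N[Y] covers at most 2l of the m + 1 points of N[x], which is enough
   unless |Y| = l and every N[y] meets N[x]; by symmetry |X| = l as well.
   Applying the same count to the symmetric difference of N[x] and N[y], with x
   in X \ Y and y in Y \ X, where an element of both X and Y covers at most two
   points, settles all cases but m <= 2 |X \ Y|.  There m is 2l-2, 2l-1 or 2l
   and X, Y have at most one common element.  By the Helly property, if N[y]
   and N[y'] meet, with y, y' in Y, then they overlap inside each N[x], so that
   N[Y] covers one point less there; in the tight cases this gain, together with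
   the bipartition of the cube, gives a contradiction. *)

Set Implicit Arguments.
Unset Strict Implicit.
Unset Printing Implicit Defensive.

Local Notation N := closed_nbr.

(* zify compares set expressions up to conversion, which is hopeless on the
   hypercube; only the cardinals in the goal itself are kept, as variables. *)
Ltac card_lia :=
  repeat match goal with |- context [card ?A] => generalize (card A) end;
  repeat match goal with H : _ |- _ => clear H end;
  intros; lia.

(** * Distance, closed neighbourhoods and parity in the cube *)

Definition diff_coords m (x y : hypercube m) : {set 'I_m} := [set i | x i != y i].

(** In the cube this amounts to Hamming distance at most two. *)
Definition meet m (x y : hypercube m) := N x :&: N y != set0.

Definition parity m (x : hypercube m) := \big[addb/false]_(i < m) x i.

Lemma diff_coordsC m (x y : hypercube m) : diff_coords x y = diff_coords y x.
Proof. by apply/setP=> i; rewrite !inE eq_sym. Qed.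

Lemma in_closed_nbr m (x y : hypercube m) :
  (y \in N x) = (#|diff_coords x y| <= 1).
Proof.
rewrite !inE [adj _ _]/(cube_adj x y) /cube_adj -/(diff_coords x y).
suff -> : (y == x) = (#|diff_coords x y| == 0) by case: #|_| => [|[]].
rewrite cards_eq0; apply/eqP/eqP => [->|/setP e].
  by apply/setP=> i; rewrite !inE eqxx.
by apply/ffunP=> i; have := e i; rewrite !inE => /negbFE/eqP.
Qed.

Lemma closed_nbr_refl m (x : hypercube m) : x \in N x.
Proof. by rewrite !inE eqxx. Qed.

Lemma closed_nbrC m (x y : hypercube m) : (y \in N x) = (x \in N y).
Proof. by rewrite !in_closed_nbr diff_coordsC. Qed.

Lemma parity_adj m (x y : hypercube m) :
  y \in N x -> y != x -> parity y = ~~ parity x.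
Proof.
rewrite !inE => /orP[-> //|/cards1P[j dj] _].
have -> : parity y = \big[addb/false]_(i < m) (x i (+) (i == j)).
  apply: eq_bigr => i _; have /setP/(_ i) := dj; rewrite !inE => <-.
  by case: (x i) (y i) => [] [].
rewrite big_split -addbT; congr addb.
by rewrite (bigD1 j) //= eqxx big1 // => i /negbTE.
Qed.

(** The point [x] and its [m] one-coordinate flips are distinct. *)
Lemma card_closed_nbr m (x : hypercube m) : m < #|N x|.
Proof.
pose flip i : hypercube m := [ffun j => x j (+) (j == i)].
have flip_inj : injective flip.
  move=> i j /ffunP/(_ i); rewrite !ffunE eqxx => e.
  by apply/eqP; case: (i == j) e => //; case: (x i).
have -> : m.+1 = #|x |: [set flip i | i : 'I_m]|.
  rewrite cardsU1 card_imset // card_ord; case: imsetP => // -[i _].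
  by move/ffunP/(_ i); rewrite ffunE eqxx; case: (x i).
apply/subset_leq_card/subsetP=> y /setU1P[->|/imsetP[i _ ->]].
  exact: closed_nbr_refl.
rewrite in_closed_nbr -(cards1 i); apply/subset_leq_card/subsetP=> j.
by rewrite !inE ffunE; case: (j == i); case: (x j).
Qed.

(* At a coordinate where x and y differ, a common neighbour v agrees with only
   one of them, and it then is the other one with that coordinate flipped. *)
Lemma card_common_nbr m (x y : hypercube m) : x != y -> #|N x :&: N y| <= 2.
Proof.
move=> nxy; have [i xyi] : exists i, x i != y i.
  apply/existsP; apply: contraR nxy; rewrite negb_exists => /forallP e.
  by apply/eqP/ffunP=> i; apply/eqP/negbNE.
pose flip (z : hypercube m) : hypercube m := [ffun j => z j (+) (j == i)].
have flipP (z v : hypercube m) : v \in N z -> v i != z i -> v = flip z.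
  rewrite in_closed_nbr leq_eqVlt ltnS leqn0 cards_eq0.
  case/orP=> [/cards1P[k dk]|/eqP/setP/(_ i)]; last first.
    by rewrite !inE eq_sym => ->.
  move/setP: dk => dk zi; apply/ffunP=> j; have := dk j; have := dk i.
  rewrite !inE ffunE eq_sym zi => /esym/eqP <-.
  by case: (j == i); case: (z j) (v j) => [] [].
apply: leq_trans (_ : #|[set flip x; flip y]| <= 2); last first.
  by rewrite cards2; case: eqP.
apply/subset_leq_card/subsetP=> v /setIP[vx vy]; rewrite !inE.
have [e|/(flipP _ _ vx)->] := eqVneq (v i) (x i); last by rewrite eqxx.
by rewrite (flipP y v) ?eqxx ?orbT // e.
Qed.

Lemma meetC m (x y : hypercube m) : meet x y = meet y x.
Proof. by rewrite /meet setIC. Qed.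

Lemma meetI m (x y v : hypercube m) : v \in N x -> v \in N y -> meet x y.
Proof. by move=> vx vy; apply/set0Pn; exists v; rewrite inE vx. Qed.

Lemma meet_diff m (x y : hypercube m) : meet x y -> #|diff_coords x y| <= 2.
Proof.
case/set0Pn=> v /setIP[]; rewrite !in_closed_nbr => vx vy.
have /subset_leq_card/leq_trans-> // :
    diff_coords x y \subset diff_coords x v :|: diff_coords y v.
  by apply/subsetP=> i; rewrite !inE; case: (x i) (y i) (v i) => [] [] [].
by rewrite (leq_trans (leq_card_setU _ _)) // (leq_add vx vy).
Qed.

(** Otherwise both difference sets equal their intersection, and coordinates being bits, [y = z].
    The intersection is where the majority of [x], [y], [z] differs from [x]. *)
Lemma card_diffI m (x y z : hypercube m) : y != z ->
  #|diff_coords x y| <= 2 -> #|diff_coords x z| <= 2 ->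
  #|diff_coords x y :&: diff_coords x z| <= 1.
Proof.
move=> nyz xy xz; rewrite leqNgt; apply: contra nyz => gt1.
have /eqP exy : diff_coords x y :&: diff_coords x z == diff_coords x y.
  by rewrite eqEcard subsetIl (leq_trans xy).
have /eqP exz : diff_coords x y :&: diff_coords x z == diff_coords x z.
  by rewrite eqEcard subsetIr (leq_trans xz).
apply/eqP/ffunP=> i; have /setP/(_ i) := etrans (esym exy) exz.
by rewrite !inE; case: (x i) (y i) (z i) => [] [] [].
Qed.

(* The common point is the coordinatewise majority of x, y and z. *)
Lemma meet_Helly m (x y z : hypercube m) : meet x y -> meet x z -> meet y z ->
  exists v, [/\ v \in N x, v \in N y & v \in N z].
Proof.
move=> mxy mxz myz.
have [e|nxy] := eqVneq x y.
  by case/set0Pn: mxz => v /setIP[vx vz]; exists v; rewrite -e.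
have [e|nxz] := eqVneq x z.
  by case/set0Pn: mxy => v /setIP[vx vy]; exists v; rewrite -e.
have [e|nyz] := eqVneq y z.
  by case/set0Pn: mxy => v /setIP[vx vy]; exists v; rewrite -e.
move: mxy mxz myz => /meet_diff xy /meet_diff xz /meet_diff yz.
have yx := xy; have zx := xz; have zy := yz.
rewrite diff_coordsC in yx; rewrite diff_coordsC in zx.
rewrite diff_coordsC in zy.
pose v : hypercube m := [ffun i => if x i == y i then x i else z i].
exists v; rewrite !in_closed_nbr; split.
- apply: leq_trans (card_diffI nyz xy xz); apply/subset_leq_card/subsetP=> i.
  by rewrite !inE ffunE; case: (x i) (y i) (z i) => [] [] [].
- apply: leq_trans (card_diffI nxz yx yz); apply/subset_leq_card/subsetP=> i.
  by rewrite !inE ffunE; case: (x i) (y i) (z i) => [] [] [].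
- apply: leq_trans (card_diffI nxy zx zy); apply/subset_leq_card/subsetP=> i.
  by rewrite !inE ffunE; case: (x i) (y i) (z i) => [] [] [].
Qed.

(** The distance is one or two, and parity tells which. *)
Lemma meet_parity m (x y : hypercube m) : x != y -> meet x y ->
  (y \in N x) = (parity x != parity y).
Proof.
move=> nxy /set0Pn[v /setIP[vx vy]].
have [yx|yNx] := boolP (y \in N x).
  by rewrite (parity_adj yx) 1?eq_sym //; case: (parity x).
have vnx : v != x by apply: contraNneq yNx => <-; rewrite closed_nbrC.
have vny : v != y by apply: contraNneq yNx => <-.
by have := parity_adj vx vnx; rewrite (parity_adj vy vny) => /negb_inj ->; rewrite eqxx.
Qed.

Lemma parity_pigeonhole m (X : {set hypercube m}) : 2 < #|X| ->
  exists x y, [/\ x \in X, y \in X, x != y & parity x = parity y].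
Proof.
move=> X3; have /dinjectivePn[x xX [y]] : ~~ dinjectiveb (@parity m) (mem X).
  apply/negP=> /dinjectiveP inj.
  have := max_card (@parity m @: X).
  by rewrite card_in_imset // card_bool leqNgt X3.
by rewrite !inE => /andP[nyx yX] e; exists x, y; rewrite eq_sym.
Qed.

(** * Counting what a union of neighbourhoods leaves uncovered *)

Lemma in_closed_nbrs (G : sgraph) (S : {set G}) v :
  reflect (exists2 w, w \in S & v \in N w) (v \in closed_nbrs S).
Proof. exact: bigcupP. Qed.

Lemma card_residue (G : sgraph) (A S : {set G}) :
  (forall w, w \in S -> #|A :&: N w| <= 2) ->
  #|A| <= #|A :\: closed_nbrs S| + 2 * #|S|.
Proof.
move=> A2; rewrite -[leqLHS](cardsID (closed_nbrs S) A) addnC leq_add2l.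
rewrite /closed_nbrs big_distrr /= mulnC -sum_nat_const.
apply: (@leq_trans (\sum_(w in S) #|A :&: N w|)); last exact: leq_sum.
elim/big_rec2: _ => [|w n B _ le]; first by rewrite cards0.
by rewrite (leq_trans (leq_card_setU _ _)) // leq_add2l.
Qed.

(** Peels off the elements that get a sharper count, before the union bound is applied to the
    others. *)
Lemma residueD1 (G : sgraph) (A S : {set G}) y : y \in S ->
  A :\: closed_nbrs S = A :\: N y :\: closed_nbrs (S :\ y).
Proof. by move=> yS; rewrite setDDl /closed_nbrs (big_setD1 y). Qed.

Lemma card_residue1 m (A S : {set hypercube m}) x : A \subset N x -> x \notin S ->
  #|A| <= #|A :\: closed_nbrs S| + 2 * #|S|.
Proof.
move=> Ax xS; apply: card_residue => w wS.
apply: leq_trans (card_common_nbr (_ : x != w)); last by apply: contraNneq xS => ->.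
by rewrite subset_leq_card // setSI.
Qed.

(* One of the at most two points of N x and N w is, by Helly, in N y as well. *)
Lemma card_residue_meet m (A : {set hypercube m}) x y w :
  A \subset N x :\: N y -> meet x y -> meet x w -> meet y w -> x != w ->
  #|A :&: N w| <= 1.
Proof.
move=> Axy mxy mxw myw nxw; have [v [vx vy vw]] := meet_Helly mxy mxw myw.
have := card_common_nbr nxw; rewrite (cardsD1 v) inE vx vw /= ltnS; apply: leq_trans.
apply/subset_leq_card/subsetP=> u /setIP[/(subsetP Axy)/setDP[ux uy] uw].
by rewrite in_setD1 inE ux uw !andbT; apply: contraNneq uy => ->.
Qed.

(** [excess X Y] and [excess Y X] partition the symmetric difference of N[X] and N[Y]. *)
Definition excess (G : sgraph) (X Y : {set G}) := closed_nbrs X :\: closed_nbrs Y.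

Lemma residue_excess (G : sgraph) (X Y : {set G}) x : x \in X ->
  N x :\: closed_nbrs Y \subset excess X Y.
Proof.
move=> xX; apply: setSD; apply/subsetP=> v vx.
by apply/in_closed_nbrs; exists x.
Qed.

Lemma excess_card (G : sgraph) (X Y : {set G}) x : x \in X ->
  #|N x :\: closed_nbrs Y| <= #|excess X Y|.
Proof. by move=> xX; apply/subset_leq_card/residue_excess. Qed.

Lemma residue_all m (S : {set hypercube m}) x : x \notin S ->
  m < #|N x :\: closed_nbrs S| + 2 * #|S|.
Proof.
move=> xS; have := card_residue1 (subxx (N x)) xS.
by apply: leq_trans; apply: card_closed_nbr.
Qed.

Lemma card_closed_nbrD m (x y : hypercube m) : x != y -> m <= #|N x :\: N y| + 1.
Proof.
move=> nxy; have := card_closed_nbr x; rewrite -(cardsID (N y) (N x)).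
have := card_common_nbr nxy; card_lia.
Qed.

(** As [y] covers nothing of [N x], this gains two over [residue_all]. *)
Lemma residue_far m (S : {set hypercube m}) x y : x \notin S -> y \in S ->
  ~~ meet x y -> m + 3 <= #|N x :\: closed_nbrs S| + 2 * #|S|.
Proof.
move=> xS yS far; rewrite (residueD1 _ yS) (cardsD1 y S) yS.
have -> : N x :\: N y = N x.
  by apply/setDidPl; rewrite -setI_eq0; apply: negbNE.
have xSy : x \notin S :\ y by rewrite inE negb_and xS orbT.
have := residue_all xSy; card_lia.
Qed.

(** By Helly, [y] and [w] together cover at most three points of [N x]: a gain of one. *)
Lemma residue_near m (S : {set hypercube m}) x y w :
  x \notin S -> y \in S -> w \in S -> y != w ->
  meet x y -> meet x w -> meet y w ->
  m + 2 <= #|N x :\: closed_nbrs S| + 2 * #|S|.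
Proof.
move=> xS yS wS nyw mxy mxw myw.
have wSy : w \in S :\ y by rewrite !inE eq_sym nyw.
rewrite (residueD1 _ yS) (residueD1 _ wSy) (cardsD1 y S) yS (cardsD1 w (S :\ y)) wSy.
have nx z : z \in S -> x != z by move=> zS; apply: contraNneq xS => ->.
have := card_residue_meet (subxx _) mxy mxw myw (nx w wS).
have := cardsID (N w) (N x :\: N y); have := card_closed_nbrD (nx y yS).
have xT : x \notin S :\ y :\ w by rewrite !inE !negb_and xS !orbT.
have sub : N x :\: N y :\: N w \subset N x by rewrite setDDl subsetDl.
have := card_residue1 sub xT; card_lia.
Qed.

(** After [y] has covered two points, [w] and [z] each add at most one: [N y] and [N w] share [x],
    and [z] falls under Helly with [x] and [y]. The gain is two. *)
Lemma residue_adj m (S : {set hypercube m}) x y w z :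
  x \notin S -> y \in S -> w \in S -> z \in S -> y != w -> z != y -> z != w ->
  y \in N x -> w \in N x -> meet x z -> meet y z ->
  m + 3 <= #|N x :\: closed_nbrs S| + 2 * #|S|.
Proof.
move=> xS yS wS zS nyw nzy nzw yx wx mxz myz.
have wSy : w \in S :\ y by rewrite !inE eq_sym nyw.
have zSyw : z \in S :\ y :\ w by rewrite !inE nzw nzy.
rewrite (residueD1 _ yS) (residueD1 _ wSy) (residueD1 _ zSyw).
rewrite (cardsD1 y S) yS (cardsD1 w (S :\ y)) wSy (cardsD1 z (S :\ y :\ w)) zSyw.
have nx u : u \in S -> x != u by move=> uS; apply: contraNneq xS => ->.
have mxy : meet x y := meetI yx (closed_nbr_refl y).
have mxw : meet x w := meetI wx (closed_nbr_refl w).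
have myw : meet y w by apply: (@meetI _ _ _ x); rewrite -closed_nbrC.
have := card_residue_meet (subxx _) mxy mxw myw (nx w wS).
have := card_residue_meet (subsetDl (N x :\: N y) (N w)) mxy mxz myz (nx z zS).
have := cardsID (N w) (N x :\: N y); have := cardsID (N z) (N x :\: N y :\: N w).
have := card_closed_nbrD (nx y yS).
have xT : x \notin S :\ y :\ w :\ z by rewrite !inE !negb_and xS !orbT.
have sub : N x :\: N y :\: N w :\: N z \subset N x by rewrite !setDDl subsetDl.
have := card_residue1 sub xT; card_lia.
Qed.

(** * Covering the symmetric difference of two neighbourhoods *)

Lemma card_pair_cover m (x y w : hypercube m) (E : {set hypercube m}) :
  E \subset (N x :\: N y) :|: (N y :\: N x) -> x != w -> y != w -> meet x y ->
  #|E :&: N w| <= 2.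
Proof.
move=> Exy nxw nyw mxy.
have le : #|E :&: N w| <= #|(N x :\: N y) :&: N w| + #|(N y :\: N x) :&: N w|.
  by rewrite (leq_trans _ (leq_card_setU _ _)) // -setIUl subset_leq_card // setSI.
have le2 u v : u != w -> #|(N u :\: N v) :&: N w| <= 2.
  move=> /card_common_nbr; apply: leq_trans.
  by rewrite subset_leq_card // setSI // subsetDl.
have far u v : ~~ meet u w -> #|(N u :\: N v) :&: N w| = 0.
  rewrite negbK => /eqP e; apply/eqP; rewrite cards_eq0 -subset0 -e setSI //.
  exact: subsetDl.
(* If [N w] misses [N x] or [N y], only one half counts. Otherwise the Helly point lies outside both
   halves, and each keeps at most one point of [N w]. *)
have [mxw|/far e] := boolP (meet x w); last by have := le2 y x nyw; move: le (e y); card_lia.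
have [myw|/far e] := boolP (meet y w); last by have := le2 x y nxw; move: le (e x); card_lia.
have := card_residue_meet (subxx _) mxy mxw myw nxw.
have := card_residue_meet (subxx _) (etrans (meetC _ _) mxy) myw mxw nyw; move: le; card_lia.
Qed.

(** The two sets on the left are disjoint, and only elements of [X :&: Y] can keep their points out
    of the excesses, at most two points each by [card_pair_cover]. *)
Lemma pair_excess m (X Y : {set hypercube m}) x y :
  x \in X :\: Y -> y \in Y :\: X -> meet x y ->
  #|N x :\: N y :\: closed_nbrs ((Y :\: X) :\ y)|
    + #|N y :\: N x :\: closed_nbrs ((X :\: Y) :\ x)|
  <= #|excess X Y| + #|excess Y X| + 2 * #|X :&: Y|.
Proof.
set E1 := _ :\: closed_nbrs _; set E2 := _ :\: closed_nbrs ((X :\: Y) :\ x).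
case/setDP=> xX xY /setDP[yY yX] mxy.
have -> : #|E1| + #|E2| = #|E1 :|: E2|.
  rewrite cardsU [E1 :&: E2](_ : _ = set0) ?cards0 ?subn0 //.
  by apply/setP=> u; rewrite !inE; case: (_ || _); rewrite ?andbF.
have E2w w : w \in X :&: Y -> #|(E1 :|: E2) :&: N w| <= 2.
  case/setIP=> wX wY; apply: (card_pair_cover _ _ _ mxy).
  - by apply: setUSS; apply: subsetDl.
  - by apply: contraNneq xY => ->.
  - by apply: contraNneq yX => ->.
have sub (A B : {set hypercube m}) a b u : a \in A ->
    u \in N a :\: N b :\: closed_nbrs ((B :\: A) :\ b) ->
    u \notin closed_nbrs (A :&: B) -> u \in excess A B.
  move=> aA /setDP[/setDP[ua ub] uBA] uAB; apply/setDP; split.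
    by apply/in_closed_nbrs; exists a.
  apply/negP=> /in_closed_nbrs[w wB uw].
  have [wA|wA] := boolP (w \in A).
    by case/negP: uAB; apply/in_closed_nbrs; exists w; rewrite // inE wA.
  have [e|nwb] := eqVneq w b; first by rewrite -e uw in ub.
  by case/negP: uBA; apply/in_closed_nbrs; exists w; rewrite // !inE nwb wA.
apply: leq_trans (card_residue E2w) _; rewrite leq_add2r.
apply: leq_trans (leq_card_setU _ _); apply/subset_leq_card/subsetP=> u.
case/setDP=> /setUP[uE|uE] uZ; rewrite inE; apply/orP; [left|right].
  exact: sub xX uE uZ.
by rewrite setIC in uZ; apply: sub yY uE uZ.
Qed.

(** Each half has at least [m - 1] points and loses at most two to each remaining element of the
    opposite difference. *)
Lemma pair_bound m (X Y : {set hypercube m}) x y :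
  x \in X :\: Y -> y \in Y :\: X -> meet x y ->
  2 * m + 2 <= #|excess X Y| + #|excess Y X| + 2 * #|X :&: Y|
               + 2 * #|X :\: Y| + 2 * #|Y :\: X|.
Proof.
move=> xXY yYX mxy; have := pair_excess xXY yYX mxy.
rewrite (cardsD1 x (X :\: Y)) xXY (cardsD1 y (Y :\: X)) yYX.
case/setDP: xXY yYX => xX xY /setDP[yY yX].
have nxy : x != y by apply: contraNneq xY => ->.
have xS : x \notin (Y :\: X) :\ y by rewrite !inE xX andbF.
have yS : y \notin (X :\: Y) :\ x by rewrite !inE yY andbF.
have := card_residue1 (subsetDl (N x) (N y)) xS.
have := card_residue1 (subsetDl (N y) (N x)) yS.
have := card_closed_nbrD nxy; rewrite eq_sym in nxy.
have := card_closed_nbrD nxy; card_lia.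
Qed.

(** By Helly, [w] takes only one point from [N x :\: N y]. *)
Lemma pair_bound_near m (X Y : {set hypercube m}) x y w :
  x \in X :\: Y -> y \in Y :\: X -> w \in Y :\: X -> y != w ->
  meet x y -> meet x w -> meet y w ->
  2 * m + 3 <= #|excess X Y| + #|excess Y X| + 2 * #|X :&: Y|
               + 2 * #|X :\: Y| + 2 * #|Y :\: X|.
Proof.
move=> xXY yYX wYX nyw mxy mxw myw; have := pair_excess xXY yYX mxy.
have wS : w \in (Y :\: X) :\ y by rewrite in_setD1 eq_sym nyw.
rewrite (residueD1 _ wS) (cardsD1 x (X :\: Y)) xXY (cardsD1 y (Y :\: X)) yYX.
rewrite (cardsD1 w ((Y :\: X) :\ y)) wS.
case/setDP: xXY yYX wYX => xX xY /setDP[yY yX] /setDP[wY _].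
have nxy : x != y by apply: contraNneq xY => ->.
have nxw : x != w by apply: contraNneq xY => ->.
have xS : x \notin (Y :\: X) :\ y :\ w by rewrite !inE xX !andbF.
have yS : y \notin (X :\: Y) :\ x by rewrite !inE yY andbF.
have sub : N x :\: N y :\: N w \subset N x by rewrite setDDl subsetDl.
have := card_residue1 sub xS.
have := card_residue1 (subsetDl (N y) (N x)) yS.
have := card_residue_meet (subxx _) mxy mxw myw nxw.
have := cardsID (N w) (N x :\: N y).
have := card_closed_nbrD nxy; rewrite eq_sym in nxy.
have := card_closed_nbrD nxy; card_lia.
Qed.

(** * The tight cases *)

Lemma common_nbr_cases m (x y a b v : hypercube m) : x != y -> a != b ->
  a \in N x -> a \in N y -> b \in N x -> b \in N y -> v \in N x -> v \in N y ->
  v = a \/ v = b.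
Proof.
move=> nxy nab ax ay bx bY vx vy; have le2 := card_common_nbr nxy.
suff /setP/(_ v) : [set a; b] = N x :&: N y.
  by rewrite in_setI vx vy !inE => /orP[]/eqP; [left|right].
apply/eqP; rewrite eqEcard cards2 nab le2 andbT.
by apply/subsetP=> u; rewrite in_setI => /set2P[]->; apply/andP.
Qed.

Lemma card_residue2 m (X Y : {set hypercube m}) x w :
  x \in X -> w \in X -> ~~ meet x w ->
  #|N x :\: closed_nbrs Y| + #|N w :\: closed_nbrs Y| <= #|excess X Y|.
Proof.
move=> xX wX; rewrite negbK => /eqP e; rewrite -cardsUI.
rewrite -setDIl e set0D cards0 addn0 -setDUl.
by apply: subset_leq_card; rewrite setDUl subUset !residue_excess.
Qed.

(* If N y and N w are disjoint, the common element z meets N x only where y and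
   w already cover it, so the l - 1 elements of Y \ X would have to cover N x. *)
Lemma excess_one_common l m (X Y : {set hypercube m}) : 2 < l -> m = 2 * l - 2 ->
  #|X :&: Y| = 1 -> #|X :\: Y| = l.-1 -> #|Y :\: X| = l.-1 ->
  {in X :\: Y & Y, forall x y, meet x y} ->
  {in Y :\: X & X, forall y x, meet y x} ->
  0 < #|excess X Y| + #|excess Y X|.
Proof.
move=> hl hm hZ hX hY mXY mYX; rewrite lt0n; apply/negP=> /eqP D0.
have /set0Pn[x xXY] : X :\: Y != set0 by rewrite -card_gt0 hX; lia.
have /card_gt1P[y [w [yYX wYX nyw]]] : 1 < #|Y :\: X| by rewrite hY; lia.
have /set0Pn[z /setIP[zX zY]] : X :&: Y != set0 by rewrite -card_gt0 hZ.
have yY : y \in Y by case/setDP: yYX.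
have wY : w \in Y by case/setDP: wYX.
have xY : x \notin Y by case/setDP: xXY.
have nxz : x != z by apply: contraNneq xY => ->.
have zN u : u \in Y :\: X -> u != z.
  by case/setDP=> _ uX; apply: contraNneq uX => ->.
(* If [N y] and [N w] meet, the bound reads [2m + 3 <= 4l - 2], against [m = 2l - 2]. *)
have [myw|] := boolP (meet y w).
  have := pair_bound_near xXY yYX wYX nyw (mXY _ _ xXY yY) (mXY _ _ xXY wY) myw.
  by rewrite D0 hZ hX hY; move: hl hm; card_lia.
rewrite negbK => /eqP yw0.
have [v [vx vy vz]] := meet_Helly (mXY _ _ xXY yY) (mXY _ _ xXY zY) (mYX _ _ yYX zX).
have [u [ux uw uz]] := meet_Helly (mXY _ _ xXY wY) (mXY _ _ xXY zY) (mYX _ _ wYX zX).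
have nvu : v != u.
  by apply/eqP=> e; move/setP/(_ v): yw0; rewrite in_setI vy e uw in_set0.
have xS : x \notin Y :\ z by rewrite !inE (negbTE xY) andbF.
have := residue_all xS; rewrite (_ : N x :\: _ = set0).
  have := cardsD1 z Y; rewrite zY -(cardsID X Y) setIC hZ hY cards0.
  by move: hl hm; card_lia.
apply/eqP; rewrite -subset0; apply/subsetP=> s /setDP[sx sYz].
have : s \in excess X Y.
  apply: (subsetP (residue_excess Y (_ : x \in X))); first by case/setDP: xXY.
  apply/setDP; split=> //; apply: contra sYz => /in_closed_nbrs[t tY st].
  apply/in_closed_nbrs; have [e|ntz] := eqVneq t z; last by exists t; rewrite // !inE ntz.
  rewrite e in st.
  case: (common_nbr_cases nxz nvu vx vz ux uz sx st) => ->.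
    by exists y; rewrite // !inE yY zN.
  by exists w; rewrite // !inE wY zN.
by move/eqP: D0; rewrite addn_eq0 cards_eq0 => /andP[/eqP-> _].
Qed.

(** Every element leaves at least one point uncovered. If two elements of [X] meet, an element of
    [Y] leaves two; if not, their own uncovered points are distinct. *)
Lemma excess_gap0 l m (X Y : {set hypercube m}) : 1 < l -> m = 2 * l ->
  #|X| = l -> #|Y| = l -> [disjoint X & Y] -> {in X & Y, forall x y, meet x y} ->
  2 < #|excess X Y| + #|excess Y X|.
Proof.
move=> hl hm hX hY dXY mXY.
have /card_gt1P[x [w [xX wX nxw]]] : 1 < #|X| by rewrite hX.
have /set0Pn[y yY] : Y != set0 by rewrite -card_gt0 hY; lia.
have xY : x \notin Y by rewrite (disjointFr dXY xX).
have wY : w \notin Y by rewrite (disjointFr dXY wX).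
have yX : y \notin X by rewrite (disjointFl dXY yY).
have := residue_all xY; have := excess_card Y xX.
have [mxw|far] := boolP (meet x w).
  have myx := etrans (meetC _ _) (mXY _ _ xX yY).
  have myw := etrans (meetC _ _) (mXY _ _ wX yY).
  have := residue_near yX xX wX nxw myx myw mxw; have := excess_card X yY.
  by rewrite hX hY; move: hl hm; card_lia.
have := residue_all yX; have := excess_card X yY.
have := residue_all wY; have := card_residue2 Y xX wX far.
by rewrite hX hY; move: hl hm; card_lia.
Qed.

Lemma same_parity_nbr m (y a b : hypercube m) : a \in N y -> y != a -> y != b ->
  meet y b -> parity a = parity b -> b \in N y.
Proof.
move=> ay nya nyb myb e; rewrite meet_parity // -e (parity_adj ay) 1?eq_sym //.
by case: (parity y).
Qed.

(** If two elements of [X] meet, each element of [Y] leaves a point uncovered. Two elements of [Y]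
    then give two such points when they are far, and one more on the side of [X] when they meet. *)
Lemma excess_gap1_far l m (X Y : {set hypercube m}) : 1 < l -> m = 2 * l - 1 ->
  #|X| = l -> #|Y| = l -> [disjoint X & Y] -> {in X & Y, forall x y, meet x y} ->
  #|excess X Y| + #|excess Y X| < 2 ->
  {in X &, forall x w, x != w -> ~~ meet x w}.
Proof.
move=> hl hm hX hY dXY mXY D1 x w xX wX nxw; apply/negP=> mxw.
have xY : x \notin Y by rewrite (disjointFr dXY xX).
have /card_gt1P[y [u [yY uY nyu]]] : 1 < #|Y| by rewrite hY.
have near v : v \in Y -> 0 < #|N v :\: closed_nbrs X|.
  move=> vY; have vX : v \notin X by rewrite (disjointFl dXY vY).
  have mvx := etrans (meetC _ _) (mXY _ _ xX vY).
  have mvw := etrans (meetC _ _) (mXY _ _ wX vY).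
  have := residue_near vX xX wX nxw mvx mvw mxw.
  by rewrite hX; move: hl hm; card_lia.
have := near y yY; have := near u uY; have := excess_card X yY.
have [myu|far] := boolP (meet y u); last first.
  by have := card_residue2 X yY uY far; move: D1; card_lia.
have := residue_near xY yY uY nyu (mXY _ _ xX yY) (mXY _ _ xX uY) myu.
by have := excess_card Y xX; rewrite hY; move: D1 hl hm; card_lia.
Qed.

(** Take [a] and [b] of equal parity in [X]. An element of [Y] covering [a] would be adjacent to [b]
    too, so that [a] and [b] meet; hence [a] itself is uncovered. *)
Lemma far_excess m (X Y : {set hypercube m}) : 2 < #|X| -> [disjoint X & Y] ->
  {in X & Y, forall x y, meet x y} ->
  {in X &, forall x w, x != w -> ~~ meet x w} -> 0 < #|excess X Y|.
Proof.
move=> X3 dXY mXY farX; have [a [b [aX bX nab eab]]] := parity_pigeonhole X3.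
apply/card_gt0P; exists a; apply: (subsetP (residue_excess Y aX)).
rewrite inE closed_nbr_refl andbT; apply: contra (farX a b aX bX nab).
case/in_closed_nbrs=> y yY ay; have nX x : x \in X -> y != x.
  by move=> xX; apply/eqP=> e; rewrite -e (disjointFl dXY yY) in xX.
apply: (@meetI _ _ _ y); rewrite -closed_nbrC //.
apply: same_parity_nbr ay _ _ _ eab; rewrite ?nX //.
by rewrite meetC mXY.
Qed.

Lemma excess_gap1 l m (X Y : {set hypercube m}) : 2 < l -> m = 2 * l - 1 ->
  #|X| = l -> #|Y| = l -> [disjoint X & Y] -> {in X & Y, forall x y, meet x y} ->
  1 < #|excess X Y| + #|excess Y X|.
Proof.
move=> hl hm hX hY dXY mXY; rewrite ltnNge; apply/negP=> D1.
have dYX : [disjoint Y & X] by rewrite disjoint_sym.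
have mYX : {in Y & X, forall y x, meet y x} by move=> y x yY xX; rewrite meetC mXY.
have farX := excess_gap1_far (ltnW hl) hm hX hY dXY mXY D1.
rewrite addnC in D1; have farY := excess_gap1_far (ltnW hl) hm hY hX dYX mYX D1.
have := far_excess _ dXY mXY farX; have := far_excess _ dYX mYX farY.
rewrite hX hY => /(_ hl) p /(_ hl); move: D1 p; card_lia.
Qed.

Lemma shared_nbr m (X Y : {set hypercube m}) : 2 < #|X| -> [disjoint X & Y] ->
  {in X & Y, forall x y, meet x y} -> excess X Y = set0 ->
  exists a b y, [/\ a \in X, b \in X & y \in Y] /\
    [/\ a != b, parity a = parity b, a \in N y & b \in N y].
Proof.
move=> X3 dXY mXY /eqP; rewrite setD_eq0 => /subsetP sub.
have [a [b [aX bX nab eab]]] := parity_pigeonhole X3.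
have /sub/in_closed_nbrs[y yY ay] : a \in closed_nbrs X.
  by apply/in_closed_nbrs; exists a; rewrite ?closed_nbr_refl.
exists a, b, y; split; split=> //.
have nX x : x \in X -> y != x.
  by move=> xX; apply/eqP=> e; rewrite -e (disjointFl dXY yY) in xX.
by apply: same_parity_nbr ay _ _ _ eab; rewrite ?nX // meetC mXY.
Qed.

(** Otherwise [residue_adj] gives [m + 3 <= 2l]. *)
Lemma third_far l m (X Y : {set hypercube m}) x a b c : 2 < l -> m = 2 * l - 2 ->
  #|Y| = l -> [disjoint X & Y] -> {in X & Y, forall x y, meet x y} ->
  excess X Y = set0 -> x \in X -> a \in Y -> b \in Y -> c \in Y -> a != b ->
  c != a -> c != b -> a \in N x -> b \in N x -> ~~ meet a c.
Proof.
move=> hl hm hY dXY mXY XY0 xX aY bY cY nab nca ncb ax bx; apply/negP=> mac.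
have xY : x \notin Y by rewrite (disjointFr dXY xX).
have := residue_adj xY aY bY cY nab nca ncb ax bx (mXY _ _ xX cY) mac.
by have := excess_card Y xX; rewrite XY0 cards0 hY; move: hl hm; card_lia.
Qed.

Lemma excess_gap2 l m (X Y : {set hypercube m}) : 2 < l -> m = 2 * l - 2 ->
  #|X| = l -> #|Y| = l -> [disjoint X & Y] -> {in X & Y, forall x y, meet x y} ->
  0 < #|excess X Y| + #|excess Y X|.
Proof.
move=> hl hm hX hY dXY mXY; rewrite lt0n addn_eq0 !cards_eq0.
apply/negP=> /andP[/eqP XY0 /eqP YX0].
have dYX : [disjoint Y & X] by rewrite disjoint_sym.
have mYX : {in Y & X, forall y x, meet y x} by move=> y x yY xX; rewrite meetC mXY.
have nXY x y : x \in X -> y \in Y -> x != y.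
  by move=> xX yY; apply/eqP=> e; rewrite -e (disjointFr dXY xX) in yY.
have X3 : 2 < #|X| by rewrite hX.
have Y3 : 2 < #|Y| by rewrite hY.
have [a [b [x [[aY bY xX] [nab eab ax bx]]]]] := shared_nbr Y3 dYX mYX YX0.
have [c [d [y [[cX dX yY] [ncd ecd cy dy]]]]] := shared_nbr X3 dXY mXY XY0.
have pa : parity a = ~~ parity x by apply: parity_adj ax _; rewrite eq_sym nXY.
have pc : parity c = ~~ parity y by apply: parity_adj cy _; rewrite nXY.
have farY z : z \in Y -> z != a -> z != b -> ~~ meet a z.
  by move=> zY za zb; apply: third_far hl hm hY dXY mXY XY0 xX aY bY zY nab za zb ax bx.
have farX z : z \in X -> z != c -> z != d -> ~~ meet c z.
  by move=> zX zc zd; apply: third_far hl hm hX dYX mYX YX0 yY cX dX zX ncd zc zd cy dy.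
(* If the parities agree, [c] and [d] are both adjacent to [a] and [b], which are then all their
   common neighbours. A third [z] in [Y] meets [c] and [d], so by Helly its neighbourhood contains
   [a] or [b], against [third_far]. *)
have [e|ne] := eqVneq (parity c) (parity x).
  have adj s t : s \in [set c; d] -> t \in [set a; b] -> t \in N s.
    move=> sP tP; have ps : parity s = parity c by case/set2P: sP => ->.
    have pt : parity t = parity a by case/set2P: tP => ->.
    have sX : s \in X by case/set2P: sP => ->.
    have tY : t \in Y by case/set2P: tP => ->.
    by rewrite meet_parity ?mXY ?nXY // ps pt pa e; case: (parity x).
  have [z zY /andP[nza nzb]] : exists2 z, z \in Y & (z != a) && (z != b).
    have /card_gt0P[z] : 0 < #|Y :\ a :\ b|.
      have := cardsD1 a Y; have := cardsD1 b (Y :\ a).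
      by rewrite aY hY !inE bY; move: hl; case: (_ != _); card_lia.
    by rewrite !inE => /and3P[nzb nza zY]; exists z; rewrite ?nza.
  have ca : a \in N c by apply: adj; rewrite !inE eqxx ?orbT.
  have cb : b \in N c by apply: adj; rewrite !inE eqxx ?orbT.
  have da : a \in N d by apply: adj; rewrite !inE eqxx ?orbT.
  have db : b \in N d by apply: adj; rewrite !inE eqxx ?orbT.
  have [v [vc vd vz]] := meet_Helly (meetI ca da) (mXY _ _ cX zY) (mXY _ _ dX zY).
  case: (common_nbr_cases ncd nab ca da cb db vc vd) => ev; rewrite ev in vz.
    by case/negP: (farY z zY nza nzb); apply: meetI (closed_nbr_refl a) vz.
  have := third_far hl hm hY dXY mXY XY0 xX bY aY zY _ nzb nza bx ax.
  by rewrite eq_sym => /(_ nab)/negP[]; apply: meetI (closed_nbr_refl b) vz.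
(* Now [x] and [y] have equal parity, so [y] is neither [a] nor [b], and [x] is neither [c] nor
   [d]. *)
have npx : parity x = parity y by move: ne; rewrite pc; case: (parity x) (parity y) => [] [].
have yN t : parity t = parity a -> y != t.
  by apply: contra_eq_neq => <-; rewrite pa npx; case: (parity y).
have xN t : parity t = parity c -> x != t.
  by apply: contra_eq_neq => <-; rewrite pc npx; case: (parity y).
have nya : ~~ meet a y by apply: farY => //; apply: yN.
have nxc : ~~ meet c x by apply: farX => //; apply: xN.
have mab : meet a b by apply: (@meetI _ _ _ x); rewrite -closed_nbrC.
have mcd : meet c d by apply: (@meetI _ _ _ y); rewrite -closed_nbrC.
have [w [wa wb wc]] := meet_Helly mab (mYX _ _ aY cX) (mYX _ _ bY cX).
have [w' [w'a w'b w'd]] := meet_Helly mab (mYX _ _ aY dX) (mYX _ _ bY dX).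
have nxd : ~~ meet d x.
  apply: third_far hl hm hX dYX mYX YX0 yY dX cX xX _ _ _ dy cy; rewrite ?xN //.
  by rewrite eq_sym.
have xa : x \in N a by rewrite closed_nbrC.
have xb : x \in N b by rewrite closed_nbrC.
have nxw : x != w by apply: contraNneq nxc => ->; apply: meetI wc (closed_nbr_refl w).
have nxw' : w' != x by apply: contraNneq nxd => <-; apply: meetI w'd (closed_nbr_refl w').
have ww' : w' = w.
  by case: (common_nbr_cases nab nxw xa xb wa wb w'a w'b) => // /eqP; rewrite (negbTE nxw').
rewrite {w' w'a w'b nxw'}ww' in w'd.
(* [x] and [w] are distinct with common neighbours [a] and [b] only, and both meet [y]. By Helly [a]
   or [b] lies in [N y], against [third_far]. *)
have mwy : meet w y.
  by apply: (@meetI _ _ _ c) => //; rewrite closed_nbrC.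
have mxw : meet x w by apply: meetI ax _; rewrite closed_nbrC.
have [v [vx vw vy]] := meet_Helly mxw (mXY _ _ xX yY) mwy.
rewrite closed_nbrC in wa; rewrite closed_nbrC in wb.
case: (common_nbr_cases nxw nab ax wa bx wb vx vw) => ev; rewrite ev in vy.
  by case/negP: nya; apply: meetI (closed_nbr_refl a) vy.
have := third_far hl hm hY dXY mXY XY0 xX bY aY yY _ (yN b _) (yN a _) bx ax.
rewrite eq_sym => /(_ nab (esym eab) erefl)/negP[].
exact: meetI (closed_nbr_refl b) vy.
Qed.

(** * Reduction to the tight cases and conclusion *)

Lemma setD_neq0 (T : finType) (X Y : {set T}) : #|X| <= #|Y| -> X != Y ->
  Y :\: X != set0.
Proof.
by move=> le; apply: contraNneq => /eqP; rewrite setD_eq0 eq_sym eqEcard le andbT.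
Qed.

Lemma small_excess_meet l m (X Y : {set hypercube m}) x : #|Y| <= l ->
  #|excess X Y| + #|excess Y X| + 2 * l < m + 3 -> x \in X :\: Y ->
  #|Y| = l /\ {in Y, forall y, meet x y}.
Proof.
move=> leY hD /setDP[xX xY]; have leX := excess_card Y xX; split.
  by have := residue_all xY; move: hD leX leY; card_lia.
move=> y yY; apply: contraLR hD => far; rewrite -leqNgt.
by have := residue_far xY yY far; move: leX leY; card_lia.
Qed.

Lemma card_excess l m (X Y : {set hypercube m}) : 2 <= l -> maxn (2 * l - 2) 4 <= m ->
  X != Y -> #|X| <= l -> #|Y| <= l ->
  m + 3 <= #|excess X Y| + #|excess Y X| + 2 * l.
Proof.
move=> hl hm nXY leX leY; rewrite leqNgt; apply/negP=> hD.
have hD' : #|excess Y X| + #|excess X Y| + 2 * l < m + 3.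
  by move: hD; card_lia.
have mX := small_excess_meet leY hD; have mY := small_excess_meet leX hD'.
(* The larger set has an element outside the other; this forces the other to have size [l], hence an
   element outside the first. *)
have [[x xXY] [y yYX]] : (exists x, x \in X :\: Y) /\ (exists y, y \in Y :\: X).
  have [le|/ltnW le] := leqP #|X| #|Y|.
    have /set0Pn[y yYX] := setD_neq0 le nXY; split; last by exists y.
    by apply/set0Pn/setD_neq0; rewrite 1?eq_sym // (mY y yYX).1.
  have /set0Pn[x xXY] : X :\: Y != set0 by apply: setD_neq0; rewrite 1?eq_sym.
  by split; [exists x | apply/set0Pn/setD_neq0; rewrite // (mX x xXY).1].
have [hY mxY] := mX x xXY; have [hX _] := mY y yYX.
have mxy : meet x y by apply: mxY; case/setDP: yYX.
have {}mX : {in X :\: Y & Y, forall x y, meet x y} by move=> u v /mX[_ /[apply]].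
have {}mY : {in Y :\: X & X, forall x y, meet x y} by move=> u v /mY[_ /[apply]].
have cX := cardsID Y X; have cY := cardsID X Y.
rewrite hX in cX; rewrite hY setIC in cY.
(* Both differences have [l - #|X :&: Y|] elements, so [pair_bound] has right side [#|excess X Y| +
   #|excess Y X| + 2l + 2 * #|X :\: Y|], where the first three terms sum to at most [m + 2]. *)
have b2t : m <= 2 * #|X :\: Y|.
  by have := pair_bound xXY yYX mxy; move: hD cX cY; card_lia.
have [Z0|nZ0] := eqVneq #|X :&: Y| 0.
  have dXY : [disjoint X & Y] by rewrite -setI_eq0 -cards_eq0 Z0.
  have mXY : {in X & Y, forall x y, meet x y}.
    by move=> u v uX vY; apply: mX; rewrite // inE uX (disjointFr dXY uX).
  have [h|[h|h]] : m = 2 * l \/ m = 2 * l - 1 \/ m = 2 * l - 2.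
  - by move: hm b2t cX; rewrite Z0 geq_max => /andP[]; card_lia.
  - by have := excess_gap0 hl h hX hY dXY mXY; move: hD h hl; card_lia.
  (* Here [m >= 4] enters: it excludes [l = 2]. *)
  - have l3 : 2 < l by move: hm hl h; card_lia.
    by have := excess_gap1 l3 h hX hY dXY mXY; move: hD h hl; card_lia.
  - have l3 : 2 < l by move: hm hl h; card_lia.
    by have := excess_gap2 l3 h hX hY dXY mXY; move: hD h hl; card_lia.
(* From [2l - 2 <= m <= 2(l - #|X :&: Y|)] with a nonempty intersection, equality holds
   throughout. *)
have hm2 : m = 2 * l - 2 by move: b2t nZ0 cX hm; card_lia.
have Z1 : #|X :&: Y| = 1 by move: b2t nZ0 cX hm; card_lia.
have l3 : 2 < l by move: hm hl hm2; card_lia.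
have tX : #|X :\: Y| = l.-1 by move: cX Z1; card_lia.
have tY : #|Y :\: X| = l.-1 by move: cY Z1; card_lia.
have := excess_one_common l3 hm2 Z1 tX tY mX mY; move: hD hm2 hl; card_lia.
Qed.

Theorem theorem41 (l m : nat) (hl : 2 <= l) (hm : maxn (2 * l - 2) 4 <= m) :
  Gr (2 ^ m) (2 ^ m - m + (2 * l - 2)) l (hypercube m).
Proof.
have m2 : m < 2 ^ m by apply: ltn_expl.
have cardV : #|hypercube m| = 2 ^ m by rewrite card_ffun card_bool card_ord.
split=> //; try by move: m2 hl hm; generalize (2 ^ m); card_lia.
move=> C hC X Y nXY leX leY; apply/negP=> /eqP/setP eC.
have sub (A B : {set hypercube m}) : closed_nbrs A :&: C =i closed_nbrs B :&: C ->
    excess A B \subset ~: C.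
  move=> e; apply/subsetP=> v /setDP[vA vB]; rewrite inE; apply: contra vB => vC.
  by have := e v; rewrite !in_setI vA vC !andbT => <-.
(* The excesses are disjoint and avoid [C], whose complement has [m - (2l - 2)] elements, one fewer
   than [card_excess] requires. *)
have le : #|excess X Y| + #|excess Y X| <= #|~: C|.
  rewrite -cardsUI (_ : _ :&: _ = set0) ?cards0 ?addn0.
    by rewrite subset_leq_card // subUset !sub // => v; rewrite eC.
  by apply/setP=> v; rewrite !inE; case: (v \in _); rewrite ?andbF.
have := card_excess hl hm nXY leX leY; have := cardsC C.
by move: le; rewrite hC cardV; move: m2 hl hm; generalize (2 ^ m); card_lia.
Qed.
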